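(* Let $\mathcal{T}\in\mathbb{F}^{n_1\times\cdots\times n_k}$ be a tensor admitting a decomposition $\mathcal{T}=\prod_i\mathcal{Z}\,\mathbf{G}_i$ with $\mathbf{G}_i\in\mathfrak{G}_i$, $i=1,\dots,k$. Let $\phi(\mathcal{X})=\sum f(|x|)$, the sum being over all entries $x$ of $\mathcal{X}$, where $f$ is a real-valued function on $[0,\infty)$. Suppose there is an index set grouping $J$ of $\{1,\dots,k\}$ into two groups such that one of the following holds: (Tensor SVD) $\mathbb{F}=\mathbb{C}$, $\mathfrak{G}_i=U(n_i)$ is the unitary group, $\operatorname{fold}^{-1}_J(\mathcal{Z})$ is a pseudo-diagonal matrix, and $x\mapsto f(\sqrt{x})$ is strictly concave with $f(0)\ge0$; or (Tensor Equivalence) $\mathfrak{G}_i=SL(n_i)$ is the special linear group, $\operatorname{fold}^{-1}_J(\mathcal{Z})=\lambda\mathbf{I}_n$ for some scalar $\lambda$ and some $n$, $x\mapsto f(\sqrt{x})$ is strictly concave and increasing, $x\mapsto f(\sqrt{e^x})$ is convex, and $f(0)\ge0$. Then $\mathcal{Z}$ is optimal in the sense that $$\phi(\mathcal{Z})=\inf_{\mathbf{G}_i\in\mathfrak{G}_i}\phi\Big(\prod_i\mathcal{T}\,\mathbf{G}_i\Big).$$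
   Context: $\mathbb{F}$ is $\mathbb{R}$ or $\mathbb{C}$. For a tensor $\mathcal{X}\in\mathbb{F}^{n_1\times\cdots\times n_k}$ and matrices $\mathbf{U}_i\in\mathbb{F}^{m_i\times n_i}$, $\prod_i\mathcal{X}\,\mathbf{U}_i:=\mathcal{X}\times_1\mathbf{U}_1\times_2\cdots\times_k\mathbf{U}_k$, where $\mathcal{X}\times_a\mathbf{U}_a$ has entries $\sum_{i_a}x_{i_1\cdots i_k}u_{j i_a}$ at position $(i_1,\dots,i_{a-1},j,i_{a+1},\dots,i_k)$. For an index set grouping $J=\{J_1,\dots,J_l\}$ (a partition of $\{1,\dots,k\}$), the unfolding $\operatorname{fold}^{-1}_J(\mathcal{X})$ is the order-$l$ tensor of size $m_1\times\cdots\times m_l$, $m_o=\prod_{t\in J_o}n_t$, with the same entries as $\mathcal{X}$, obtained by merging the modes in each $J_o$ into a single mode (in a fixed order); vectorizations of $\mathcal{X}$ and its unfolding are identified. For $l=2$ it is a matrix. A matrix $\mathbf{A}$ is pseudo-diagonal if there exist permutation matrices $\mathbf{P},\mathbf{Q}$ such that $\mathbf{P}\mathbf{A}\mathbf{Q}^\top$ is diagonal. *)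

(* Defs.v *)
From HB Require Import structures.
From mathcomp Require Import all_boot all_order all_algebra.
From mathcomp Require Import complex spectral.
From mathcomp Require Import all_classical all_reals all_analysis.

Set Implicit Arguments.
Unset Strict Implicit.
Unset Printing Implicit Defensive.

Import Order.TTheory GRing.Theory Num.Theory.
Import numFieldNormedType.Exports.

Local Open Scope classical_set_scope.
Local Open Scope ring_scope.

Inductive scalar_kind := RealScalars | ComplexScalars.

Definition scalars (R : realType) (c : scalar_kind) : numFieldType :=
  match c with RealScalars => R | ComplexScalars => complex R end.

(* The norm of [complex R] takes its values in [complex R]; it is real. *)
Definition modulus (R : realType) (c : scalar_kind) : scalars R c -> R :=
  match c return scalars R c -> R with
  | RealScalars => fun x : R => `|x|
  | ComplexScalars => fun x : complex R => complex.Re `|x|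
  end.

Definition unitary_group (R : realType) (c : scalar_kind) (m : nat) :
    set 'M[scalars R c]_m :=
  match c return set 'M[scalars R c]_m with
  | RealScalars => [set U : 'M[R]_m | U *m U^T = 1%:M]
  | ComplexScalars => [set U : 'M[complex R]_m | U \is unitarymx]
  end.

Definition special_linear_group (F : fieldType) (m : nat) : set 'M[F]_m :=
  [set U | \det U = 1].

Section Tensors.
Variables (k : nat) (n : 'I_k -> nat).

(* Modes and positions are numbered from 0. *)
Definition multi_index := {dffun forall a : 'I_k, 'I_(n a)}.

Definition tensor (F : Type) := {ffun multi_index -> F}.

Definition set_index (j : multi_index) (a : 'I_k) (i : 'I_(n a)) : multi_index :=
  [ffun b => eqtype.dfwith (T := fun a => 'I_(n a)) j i b].

(* Only square factors are needed here, so the size of the tensor is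
   unchanged. *)
Definition mode_product (F : fieldType) (X : tensor F) (a : 'I_k)
    (U : 'M[F]_(n a)) : tensor F :=
  [ffun j : multi_index => \sum_(i < n a) X (set_index j i) * U (j a) i].

Definition multi_product (F : fieldType) (X : tensor F)
    (U : forall a, 'M[F]_(n a)) : tensor F :=
  foldl (fun Y a => mode_product Y (U a)) X (enum 'I_k).

Definition block_index (B : {set 'I_k}) :=
  {dffun forall a : {a : 'I_k | a \in B}, 'I_(n (val a))}.

Definition restrict_index (B : {set 'I_k}) (i : multi_index) : block_index B :=
  [ffun a => i (val a)].

Definition block_size (B : {set 'I_k}) : nat := (\prod_(a in B) n a)%N.

(* Hence every block has a merging. *)
Lemma card_block_index (B : {set 'I_k}) : #|block_index B| = block_size B.
Proof.
rewrite card_dep_ffun foldrE big_image /= /block_size.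
rewrite (big_sub (mem B) n) /=.
by apply: eq_bigr => a _; rewrite card_ord.
Qed.

(* The order in which the modes of [B] are merged into one: a numbering of the
   positions of the block. *)
Record merging (B : {set 'I_k}) := Merging {
  merge :> block_index B -> 'I_(block_size B);
  merge_bij : bijective merge }.

Definition two_grouping (J1 J2 : {set 'I_k}) : bool :=
  (J1 != J2) && finset.partition [set J1; J2]%SET [set: 'I_k]%SET.

(* For a grouping, exactly one multi-index [i] is merged into [(r, s)], so that
   each sum consists of a single entry of [X]: see [unfoldingE]. *)
Definition unfolding (F : fieldType) (J1 J2 : {set 'I_k})
    (e1 : merging J1) (e2 : merging J2) (X : tensor F) :
    'M[F]_(block_size J1, block_size J2) :=
  \matrix_(r, s) \sum_(i : multi_index |
      (e1 (restrict_index J1 i) == r) && (e2 (restrict_index J2 i) == s)) X i.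

Lemma unfoldingE (F : fieldType) (J1 J2 : {set 'I_k})
    (e1 : merging J1) (e2 : merging J2) (X : tensor F) (i : multi_index) :
  two_grouping J1 J2 ->
  unfolding e1 e2 X (e1 (restrict_index J1 i)) (e2 (restrict_index J2 i)) = X i.
Proof.
move=> /andP[_ /and3P[/eqP cov _ _]]; rewrite mxE (big_pred1 i) // => j.
apply/andP/eqP => [[/eqP h1 /eqP h2]|-> //].
have {}h1 := bij_inj (merge_bij e1) h1.
have {}h2 := bij_inj (merge_bij e2) h2.
apply/ffunP => a.
have : a \in finset.cover [set J1; J2]%SET by rewrite cov finset.in_setT.
case/finset.bigcupP => B; rewrite finset.in_set2 => /orP[]/eqP -> aB.
- by have /ffunP/(_ (Sub a aB)) := h1; rewrite !ffunE.
- by have /ffunP/(_ (Sub a aB)) := h2; rewrite !ffunE.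
Qed.

Definition entry_sum (R : realType) (c : scalar_kind) (f : R -> R)
    (X : tensor (scalars R c)) : R :=
  \sum_(i : multi_index) f (modulus (X i)).

End Tensors.

Definition pseudo_diagonal (F : fieldType) (p q : nat) (A : 'M[F]_(p, q)) :=
  exists (P : 'M[F]_p) (Q : 'M[F]_q),
    [/\ is_perm_mx P, is_perm_mx Q & is_diag_mx (P *m A *m Q^T)].

Definition is_scalar_identity (F : fieldType) (p q : nat) (A : 'M[F]_(p, q)) :=
  exists (lambda : F) (m : nat) (hp : p = m) (hq : q = m),
    castmx (hp, hq) A = lambda%:M.

Definition strictly_concave_on (R : realType) (D : set R) (g : R -> R) :=
  forall x y t : R, D x -> D y -> x != y -> 0 < t < 1 ->
    t * g x + (1 - t) * g y < g (t * x + (1 - t) * y).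

(* Main.v *)
(* Unfolding along the grouping turns the action of the [G_i] on [Z] into
   [A |-> K1 *m A *m K2^T], where [K1] and [K2] are products of matrices of the
   form [1 (x) U (x) 1], hence again unitary (resp. of determinant one).  Put
   [h x = f (sqrt x) - f 0], a concave function on the nonnegative reals with
   [h 0 = 0], hence subadditive, and let [B = K1 *m A *m K2^T].  If [V] is
   unitary and [(V B)(V B)^* = diag d], then the squared norm of row [r] of [B]
   is the average [sum_j |V j r|^2 d_j], so subadditivity along the rows and
   Jensen's inequality give [sum_(r, s) h |B r s|^2 >= sum_j h (d_j)].
   In the unitary case [V = K1^*] diagonalizes [B B^*], with the [d_j] the
   squared moduli of the nonzero entries of [A] (or 0).  In the special linear
   case [V] comes from the spectral theorem; since [prod_j d_j = |det B|^2 =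
   |lambda|^(2 m)], convexity of [h \o exp] gives
   [sum_j h (d_j) >= m h (|lambda|^2)]. *)

Require Import Defs.
From HB Require Import structures.
From mathcomp Require Import all_boot all_order all_algebra.
From mathcomp Require Import perm complex spectral.
From mathcomp Require Import all_classical all_reals all_analysis.
From mathcomp Require Import ring lra.

Set Implicit Arguments.
Unset Strict Implicit.
Unset Printing Implicit Defensive.

Import Order.TTheory GRing.Theory Num.Theory.
Import numFieldNormedType.Exports.

Local Open Scope classical_set_scope.
Local Open Scope ring_scope.

(** * Determinants: renumbering and block diagonal matrices *)

Section Reindexing.
Variable F : comNzRingType.

Lemma det_castmx (p q : nat) (E : p = q) (A : 'M[F]_p) :
  \det (castmx (E, E) A) = \det A.
Proof. by case: q / E; rewrite castmx_id. Qed.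

Lemma det_size0 (p : nat) (A : 'M[F]_p) : p = 0%N -> \det A = 1.
Proof. by move=> p0; subst p; exact: det_mx00. Qed.

Lemma det_mxdiag (m : nat) (p_ : 'I_m -> nat) (B_ : forall i, 'M[F]_(p_ i)) :
  \det (\mxdiag_i B_ i) = \prod_i \det (B_ i).
Proof.
elim: m p_ B_ => [|m IHm] p_ B_.
  by rewrite det_size0 ?big_ord0.
by rewrite mxdiag_recl det_castmx det_ublock IHm big_ord_recl.
Qed.

(** The two numberings differ by a permutation applied to rows and columns alike, so its sign enters
    squared. *)
Lemma det_renumber (T : finType) (M : T -> T -> F) (p q : nat)
    (d : 'I_p -> T) (d' : 'I_q -> T) :
  bijective d -> bijective d' ->
  \det (\matrix_(r, s) M (d r) (d s)) = \det (\matrix_(r, s) M (d' r) (d' s)).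
Proof.
move=> bij_d bij_d'.
have E : p = q.
  by rewrite -(card_ord p) -(card_ord q) (bij_eq_card bij_d) (bij_eq_card bij_d').
case: q / E d' bij_d' => d' bij_d'.
have [e dK eK] := bij_d.
have inj_s : injective (e \o d').
  by apply: inj_comp (bij_inj bij_d'); apply: can_inj eK.
pose A := \matrix_(r, s) M (d r) (d s).
have -> : \matrix_(r, s) M (d' r) (d' s) =
    row_perm (perm inj_s) (col_perm (perm inj_s) A).
  by apply/matrixP => r s; rewrite !mxE !permE /= !eK.
rewrite row_permE col_permE !det_mulmx !det_perm odd_permV.
by rewrite mulrCA -expr2 -signr_odd /= sqrr_sign mulr1.
Qed.

End Reindexing.

(** * Mode products as matrices *)

Section ModeMatrix.
Variables (I : finType) (n : I -> nat).
Local Notation index := {dffun forall a : I, 'I_(n a)}.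

Implicit Types x y : index.

(** This is [set_index] over an arbitrary finite type of modes: the modes of a block index form a
    sigma type, not some ['I_k]. *)
Definition update (x : index) (a : I) (i : 'I_(n a)) : index :=
  [ffun b => eqtype.dfwith (T := fun a => 'I_(n a)) x i b].

Lemma update_in x a (i : 'I_(n a)) : update x i a = i.
Proof. by rewrite ffunE eqtype.dfwith_in. Qed.

Lemma update_out x a (i : 'I_(n a)) b : a != b -> update x i b = x b.
Proof. by move=> ab; rewrite ffunE eqtype.dfwith_out. Qed.

Lemma updateP x a (i : 'I_(n a)) y :
  y a = i -> (forall b, a != b -> y b = x b) -> y = update x i.
Proof.
move=> ya yb; apply/ffunP => b; have [<-|ab] := eqVneq a b.
  by rewrite update_in.
by rewrite update_out // yb.
Qed.

Lemma update_id x a : update x (x a) = x.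
Proof. by apply/esym/updateP. Qed.

Lemma update_update x a (i j : 'I_(n a)) : update (update x i) j = update x j.
Proof.
by apply: updateP => [|b ab]; rewrite ?update_in // !update_out.
Qed.

(** Either equation says that [x] and [y] agree away from the mode [a]. *)
Lemma update_eq x y a (i : 'I_(n a)) :
  (update y i == update x i) = (update y (x a) == x).
Proof.
apply/eqP/eqP => [|<-]; last by rewrite !update_update.
move=> /(congr1 (fun z => update z (x a))) /=.
by rewrite !update_update update_id.
Qed.

Lemma updateC x a b (i : 'I_(n a)) (j : 'I_(n b)) : a != b ->
  update (update x i) j = update (update x j) i.
Proof.
move=> ab; apply: updateP => [|c ac].
  by rewrite update_out ?update_in // eq_sym.
have [<-|bc] := eqVneq b c; first by rewrite !update_in.
by rewrite !update_out.
Qed.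

Variable F : comNzRingType.

(** The entry of [1 (x) U (x) 1] at row [x] and column [y]; the test says that [x] and [y] agree
    away from [a]. *)
Definition mode_entry (a : I) (U : 'M[F]_(n a)) (x y : index) : F :=
  if update y (x a) == x then U (x a) (y a) else 0.

Lemma sum_mode_entry (a : I) (U : 'M[F]_(n a)) (x : index) (G : index -> F) :
  \sum_y mode_entry U x y * G y = \sum_(i < n a) U (x a) i * G (update x i).
Proof.
under eq_bigr => y _ do rewrite /mode_entry (fun_if (fun u => u * G y)) mul0r.
rewrite -big_mkcond /= (reindex_omap (update x (a := a)) (fun y => Some (y a))) /=.
  by apply: eq_big => i; rewrite ?update_in // update_update update_id !eqxx.
move=> y /eqP xy; congr Some; rewrite -[in LHS]xy update_update update_id //.
Qed.

Variables (N : nat) (d : 'I_N -> index) (e : index -> 'I_N).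
Hypotheses (dK : cancel d e) (eK : cancel e d).

Definition mode_mx (a : I) (U : 'M[F]_(n a)) : 'M[F]_N :=
  \matrix_(r, s) mode_entry U (d r) (d s).

Lemma mode_mx_mul (a : I) (U : 'M[F]_(n a)) p (B : 'M[F]_(N, p)) (x : index) s :
  (mode_mx U *m B) (e x) s = \sum_(i < n a) U (x a) i * B (e (update x i)) s.
Proof.
rewrite mxE -(sum_mode_entry U x (fun y => B (e y) s)).
rewrite (reindex d) /=; last by exists e => ? _.
by apply: eq_bigr => r _; rewrite mxE eK dK.
Qed.

Lemma mode_mxM (a : I) (U V : 'M[F]_(n a)) :
  mode_mx U *m mode_mx V = mode_mx (U *m V).
Proof.
apply/matrixP => r s; rewrite -(dK r) mode_mx_mul !mxE !eK.
rewrite /mode_entry.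
under eq_bigr => i _ do rewrite mxE eK /mode_entry update_in.
set x := d r; set y := d s.
(* The test no longer depends on [i] and can be decided once for the whole sum. *)
under eq_bigr => i _ do rewrite update_eq.
case: ifP => _; first by rewrite mxE.
by rewrite big1 // => i _; rewrite mulr0.
Qed.

Lemma mode_mx1 (a : I) : mode_mx (1%:M : 'M[F]_(n a)) = 1%:M.
Proof.
apply/matrixP => r s; rewrite !mxE /mode_entry mxE -(inj_eq (can_inj dK)).
have [<-|rs] := eqVneq (d r) (d s); first by rewrite update_id !eqxx.
case: ifP => // /eqP E; case: eqP => // xy.
by move: rs; rewrite -E xy update_id eqxx.
Qed.

Lemma tr_mode_mx (a : I) (U : 'M[F]_(n a)) : (mode_mx U)^T = mode_mx U^T.
Proof.
apply/matrixP => r s; rewrite !mxE /mode_entry mxE.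
suff -> : (update (d r) (d s a) == d s) = (update (d s) (d r a) == d r) by [].
by apply/eqP/eqP => <-; rewrite update_update update_id.
Qed.

Lemma map_mode_mx (f : {rmorphism F -> F}) (a : I) (U : 'M[F]_(n a)) :
  map_mx f (mode_mx U) = mode_mx (map_mx f U).
Proof.
by apply/matrixP => r s; rewrite !mxE /mode_entry mxE; case: ifP; rewrite ?rmorph0.
Qed.

(* Numbering the positions fibre by fibre along the mode [a] makes the matrix
   block diagonal, with all its blocks equal to [U]. *)
Lemma det_mode_mx (a : I) (U : 'M[F]_(n a)) : \det U = 1 -> \det (mode_mx U) = 1.
Proof.
move=> detU.
have [N0|N_gt0] := posnP N.
  exact: det_size0.
(* Any position of the mode [a] would do; a fibre is represented by its member whose coordinate
   there is [i0]. *)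
pose i0 := d (Ordinal N_gt0) a.
pose rest := {x : index | x a == i0}.
pose m := #|{: rest}|.
pose sp := (\sum_(i < m) n a)%N.
pose slot := {i : 'I_m & 'I_(n a)}.
pose c (t : slot) : index := update (val (enum_val (tag t) : rest)) (tagged t).
have base x : update x i0 a == i0 by rewrite update_in.
pose proj x : rest := exist _ (update x i0) (base x).
pose c' x : slot := Tagged (fun=> 'I_(n a)) (i := enum_rank (proj x)) (x a).
have proj_c t : proj (c t) = enum_val (tag t).
  apply: val_inj; rewrite /= /c update_update.
  by case: (enum_val _) => x /= /eqP xi; rewrite -xi update_id.
have cK : cancel c c'.
  by move=> t; rewrite /c' proj_c enum_valK update_in; case: t.
have c'K : cancel c' c.
  by move=> x; rewrite /c /= enum_rankK update_update update_id.
have bij_c : bijective (c \o @tagnat.sig m (fun=> n a)).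
  by apply: bij_comp tagnat.sig_bij; exists c'.
have -> : \det (mode_mx U) = \det (\mxdiag_(i < m) U).
  rewrite /mode_mx (det_renumber _ _ bij_c); last by exists e.
  congr (\det _); apply/matrixP => r s; rewrite !mxE /=.
  (* Agreement away from [a] means lying in the same fibre, that is, in the same block. *)
  have E t t' : (update (c t') (c t a) == c t) = (tag t == tag t').
    rewrite -(inj_eq enum_val_inj) -!proj_c -(inj_eq val_inj) /=.
    by rewrite [RHS]eq_sym update_eq.
  rewrite /mode_entry E /c !update_in.
  by case: ifP => _; rewrite ?conform_mx_id // mxE.
by rewrite det_mxdiag big1.
Qed.

End ModeMatrix.

(** * Unfolding of a multi-product *)

(** What the argument needs of the unitary and special linear groups alike. All sizes are treated
    together, as [family_mode] passes from the size of a mode to that of a block. *)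
Record multiplicative_family (F : comNzRingType)
    (Q : forall m, set 'M[F]_m) : Prop := MultiplicativeFamily {
  family1 : forall m, Q m 1%:M;
  familyM : forall m (U V : 'M[F]_m), Q m U -> Q m V -> Q m (U *m V);
  familyV : forall m (U : 'M[F]_m), Q m U -> exists2 V, Q m V & V *m U = 1%:M;
  family_mode : forall (I : finType) (n : I -> nat) N
      (d : 'I_N -> {dffun forall a : I, 'I_(n a)}) (a : I) (U : 'M[F]_(n a)),
    bijective d -> Q (n a) U -> Q N (mode_mx d U) }.

Section Unfolding.
Variables (k : nat) (n : 'I_k -> nat) (F : fieldType).
Implicit Types (X : tensor n F) (i j : multi_index n) (J : {set 'I_k}).

Lemma mode_productE X (a : 'I_k) (U : 'M[F]_(n a)) j :
  mode_product X U j = \sum_(i < n a) X (update j i) * U (j a) i.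
Proof. by rewrite ffunE. Qed.

Lemma mode_productM X (a : 'I_k) (U V : 'M[F]_(n a)) :
  mode_product (mode_product X U) V = mode_product X (V *m U).
Proof.
apply/ffunP => j; rewrite !mode_productE.
under eq_bigr => i _ do rewrite mode_productE update_in big_distrl /=.
rewrite exchange_big; apply: eq_bigr => l _; rewrite mxE big_distrr /=.
by apply: eq_bigr => i _; rewrite update_update -mulrA [U i l * _]mulrC.
Qed.

Lemma mode_product1 X (a : 'I_k) : mode_product X (1%:M : 'M[F]_(n a)) = X.
Proof.
apply/ffunP => j; rewrite mode_productE (bigD1 (j a)) //= update_id mxE eqxx mulr1.
rewrite big1 ?addr0 // => i; rewrite mxE eq_sym => /negPf ->.
by rewrite mulr0.
Qed.

Lemma mode_productC X (a b : 'I_k) (U : 'M[F]_(n a)) (V : 'M[F]_(n b)) :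
  a != b ->
  mode_product (mode_product X U) V = mode_product (mode_product X V) U.
Proof.
move=> ab; have ba : b != a by rewrite eq_sym.
apply/ffunP => j; rewrite !mode_productE.
under eq_bigr => i _ do rewrite mode_productE update_out // big_distrl /=.
rewrite exchange_big; apply: eq_bigr => l _.
rewrite mode_productE update_out // big_distrl; apply: eq_bigr => i _ /=.
by rewrite updateC // mulrAC.
Qed.

(** Products in distinct modes commute, so [V a] moves past the later factors and cancels against
    [U a]. *)
Lemma multi_productK X (U V : forall a, 'M[F]_(n a)) :
  (forall a, V a *m U a = 1%:M) -> multi_product (multi_product X U) V = X.
Proof.
move=> VU; rewrite /multi_product; have := enum_uniq 'I_k.
pose app := foldl (fun Y a => mode_product Y (U a)).
elim: (enum 'I_k) X => [|a s IHs] X //= /andP[as_ uniq_s].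
have appC t Y : a \notin t ->
    mode_product (app Y t) (V a) = app (mode_product Y (V a)) t.
  elim: t Y => [|b t IHt] Y //=; rewrite in_cons negb_or => /andP[ab at_].
  by rewrite IHt // (mode_productC _ (V a)).
by rewrite -/(app _ s) appC // mode_productM VU mode_product1 IHs.
Qed.

Lemma restrict_update J j (b : {a : 'I_k | a \in J}) (i : 'I_(n (val b))) :
  restrict_index J (update j i) =
  update (n := fun b => n (val b)) (restrict_index J j) i.
Proof.
apply: updateP => [|c bc]; rewrite ffunE ?update_in // update_out ?ffunE //.
Qed.

Lemma restrict_update_out J j (a : 'I_k) (i : 'I_(n a)) : a \notin J ->
  restrict_index J (update j i) = restrict_index J j.
Proof.
move=> aJ; apply/ffunP => b; rewrite [LHS]ffunE [RHS]ffunE update_out //.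
by apply: contraNneq aJ => ->; exact: valP.
Qed.

Lemma two_groupingC J1 J2 : two_grouping J1 J2 = two_grouping J2 J1.
Proof. by rewrite /two_grouping eq_sym finset.setUC. Qed.

Lemma two_grouping_in J1 J2 : two_grouping J1 J2 ->
  forall a, (a \in J2) = (a \notin J1).
Proof.
case/andP=> J12 /and3P[/eqP cov /finset.trivIsetP triv _] a.
have dis := disjointFr (triv J1 J2 (finset.set21 _ _) (finset.set22 _ _) J12).
have : a \in finset.cover [set J1; J2]%SET by rewrite cov finset.in_setT.
case/finset.bigcupP => B; rewrite finset.in_set2 => /orP[]/eqP -> aB.
  by rewrite aB dis.
by rewrite aB; apply/esym/negP => /dis; rewrite aB.
Qed.

Variables (J1 J2 : {set 'I_k}).
Hypothesis J12 : two_grouping J1 J2.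

(** Each mode lies in exactly one block, so the two prescriptions never conflict. *)
Lemma glue_index (x : block_index n J1) (y : block_index n J2) :
  exists2 j, restrict_index J1 j = x & restrict_index J2 j = y.
Proof.
have part := two_grouping_in J12.
have glue a : exists i : 'I_(n a),
    (forall h : a \in J1, i = x (exist _ a h)) /\
    (forall h : a \in J2, i = y (exist _ a h)).
  have [aJ1|aJ2] : a \in J1 \/ a \in J2.
    by rewrite part; case: (a \in J1); [left|right].
    exists (x (exist _ a aJ1)); split => h.
      by rewrite (bool_irrelevance h aJ1).
    by exfalso; move: h; rewrite part aJ1.
  exists (y (exist _ a aJ2)); split => h; last by
    rewrite (bool_irrelevance h aJ2).
  by exfalso; move: aJ2; rewrite part h.
exists [ffun a => sval (cid (glue a))]; apply/ffunP => -[a h]; rewrite !ffunE /=.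
  by case: cid => i []/=.
by case: cid => i []/=.
Qed.

Variables (e1 : merging n J1) (e2 : merging n J2).

(** Reduces identities between unfoldings to positions where [unfoldingE] applies. *)
Lemma unfolding_entry r s :
  exists j, r = e1 (restrict_index J1 j) /\ s = e2 (restrict_index J2 j).
Proof.
have [d1 _ d1K] := merge_bij e1; have [d2 _ d2K] := merge_bij e2.
by have [j jx jy] := glue_index (d1 r) (d2 s); exists j; rewrite jx jy.
Qed.

(** Multi-indices correspond bijectively to pairs [(r, s)], so entrywise sums can be computed on the
    unfolding. *)
Lemma unfolding_sum (V : nmodType) (g : F -> V) X :
  \sum_j g (X j) = \sum_r \sum_s g (unfolding e1 e2 X r s).
Proof.
rewrite pair_big /=.
pose h j := (e1 (restrict_index J1 j), e2 (restrict_index J2 j)).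
have h_inj : injective h.
  move=> i j [/(bij_inj (merge_bij e1)) h1 /(bij_inj (merge_bij e2)) h2].
  apply/ffunP => a; have [aJ|aJ] := boolP (a \in J1).
    by have /ffunP/(_ (exist _ a aJ)) := h1; rewrite !ffunE.
  have {}aJ : a \in J2 by rewrite (two_grouping_in J12).
  by have /ffunP/(_ (exist _ a aJ)) := h2; rewrite !ffunE.
have h_surj p : exists j, p = h j.
  by case: p => r s; have [j [-> ->]] := unfolding_entry r s; exists j.
have [h' hK h'K] : bijective h.
  exists (fun p => sval (cid (h_surj p))) => [j|p]; last by case: cid.
  by apply: h_inj; case: cid.
rewrite (reindex h) /=; last by exists h' => ? _.
by apply: eq_bigr => j _; rewrite unfoldingE.
Qed.

End Unfolding.

(** Transfers facts about the modes of [J1] to those of [J2]. *)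
Lemma tr_unfolding (k : nat) (n : 'I_k -> nat) (F : fieldType) J1 J2
    (e1 : merging n J1) (e2 : merging n J2) (X : tensor n F) :
  (unfolding e1 e2 X)^T = unfolding e2 e1 X.
Proof. by apply/matrixP => r s; rewrite !mxE; apply: eq_bigl => i; rewrite andbC. Qed.

(** A mode of [J1] affects only the row index, so its product becomes a left multiplication. *)
Lemma unfolding_mode_product (k : nat) (n : 'I_k -> nat) (F : fieldType) J1 J2
    (e1 : merging n J1) (e2 : merging n J2) (X : tensor n F) d1
    (b : {a : 'I_k | a \in J1}) (U : 'M[F]_(n (val b))) :
  two_grouping J1 J2 -> cancel d1 e1 -> cancel e1 d1 ->
  unfolding e1 e2 (mode_product X U) =
  mode_mx (n := fun b => n (val b)) d1 U *m unfolding e1 e2 X.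
Proof.
move=> J12 d1K e1K; apply/matrixP => r s.
have [j [-> ->]] := unfolding_entry J12 e1 e2 r s.
rewrite unfoldingE // (mode_mx_mul d1K e1K) mode_productE.
have bJ2 : val b \notin J2 by rewrite (two_grouping_in J12) negbK (valP b).
apply: eq_bigr => i _; rewrite mulrC [restrict_index J1 j b]ffunE -restrict_update.
by rewrite -[in RHS](restrict_update_out j i bJ2) unfoldingE.
Qed.

(** Mode by mode: a factor from [J1] is absorbed into [K1], one from [J2], by transposition, into
    [K2]. *)
Lemma unfolding_multi_product (k : nat) (n : 'I_k -> nat) (F : fieldType) J1 J2
    (e1 : merging n J1) (e2 : merging n J2) (Q : forall m, set 'M[F]_m)
    (X : tensor n F) (U : forall a, 'M[F]_(n a)) :
  two_grouping J1 J2 -> multiplicative_family Q -> (forall a, Q (n a) (U a)) ->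
  exists K1 K2, [/\ Q _ K1, Q _ K2 &
    unfolding e1 e2 (multi_product X U) = K1 *m unfolding e1 e2 X *m K2^T].
Proof.
move=> J12 famQ QU; rewrite /multi_product; elim: (enum 'I_k) X => [|a s IHs] X /=.
  exists 1%:M, 1%:M; split; try exact: family1.
  by rewrite mul1mx trmx1 mulmx1.
have [K1 [K2 [QK1 QK2 ->]]] := IHs (mode_product X (U a)).
have [d1 e1K d1K] := merge_bij e1; have [d2 e2K d2K] := merge_bij e2.
have [aJ|aJ] := boolP (a \in J1).
  pose b : {a : 'I_k | a \in J1} := exist _ a aJ.
  rewrite (unfolding_mode_product (b := b) _ _ _ J12 d1K e1K) mulmxA.
  exists (K1 *m mode_mx (n := fun b => n (val b)) d1 (a := b) (U a)), K2; split => //.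
  by apply: familyM => //; apply: family_mode => //; exists e1.
have {}aJ : a \in J2 by rewrite (two_grouping_in J12).
pose b : {a : 'I_k | a \in J2} := exist _ a aJ.
have J21 : two_grouping J2 J1 by rewrite two_groupingC.
rewrite -tr_unfolding (unfolding_mode_product (b := b) _ _ _ J21 d2K e2K).
rewrite trmx_mul tr_unfolding.
exists K1, (K2 *m mode_mx (n := fun b => n (val b)) d2 (a := b) (U a)); split => //.
  by apply: familyM => //; apply: family_mode => //; exists e2.
by rewrite trmx_mul !mulmxA.
Qed.

Lemma multiplicative_special_linear (F : fieldType) :
  multiplicative_family (@special_linear_group F).
Proof.
split=> [m|m U V detU detV|m U detU|I n N d a U [e dK eK] detU].
- exact: det1.
- by rewrite /special_linear_group /= det_mulmx detU detV mulr1.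
- have Uunit : U \in unitmx by rewrite unitmxE detU unitr1.
  by exists (invmx U); rewrite ?mulVmx // /special_linear_group /= det_inv detU invr1.
- exact: det_mode_mx detU.
Qed.

Local Open Scope sesquilinear_scope.

(** For [family_mode]: [mode_mx] respects products, transposes, conjugation and the identity, hence
    the equation [U U^* = 1]. *)
Lemma multiplicative_unitary (R : realType) :
  multiplicative_family (@unitary_group R ComplexScalars).
Proof.
split=> [m|m U V|m U|I n N d a U [e dK eK]] /=.
- by apply/unitarymxP; rewrite trmx1 map_mx1 mulmx1.
- exact: mul_unitarymx.
- move=> unitU; exists (U^t*); first by rewrite trmxC_unitary.
  by rewrite -invmx_unitary // mulVmx // unitarymx_unit.
- move=> /unitarymxP UU; apply/unitarymxP.
  by rewrite tr_mode_mx map_mode_mx (mode_mxM dK eK) UU (mode_mx1 _ dK).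
Qed.

(** * Concave functions and squared moduli *)

Section Concavity.
Variable R : realType.
Implicit Types (D : set R) (g h : R -> R).

(** Stability of [D] under convex combinations is built in so that [jensen] can add one point at a
    time. *)
Definition concave_on D g := forall x y t : R, D x -> D y -> 0 <= t <= 1 ->
  D (t * x + (1 - t) * y) /\
  t * g x + (1 - t) * g y <= g (t * x + (1 - t) * y).

Lemma jensen D g (I : finType) (w x : I -> R) :
  concave_on D g -> (forall i, 0 <= w i) -> (forall i, D (x i)) ->
  \sum_i w i = 1 -> \sum_i w i * g (x i) <= g (\sum_i w i * x i).
Proof.
move=> g_concave w_ge0 Dx sum_w.
(* Weights of sum 1 force [I] to be inhabited; [x i0] is the default point of [D] while the
   accumulated weight is 0. *)
have I_inhab : exists i : I, true.
  apply/existsP; rewrite -[[exists _, _]]negbK negb_exists; apply/negP => /forallP noI.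
  by have := oner_neq0 R; rewrite -sum_w big1 ?eqxx // => i; have := noI i.
case: I_inhab => i0 _.
(* [y] is a weighted mean of the points met so far; leaving the weights unnormalized permits a total
   of 0. *)
suff [y [Dy yx yg]] : exists y, [/\ D y, \sum_i w i * x i = (\sum_i w i) * y &
    \sum_i w i * g (x i) <= (\sum_i w i) * g y].
  by rewrite yx; move: yg; rewrite sum_w !mul1r.
elim: (index_enum I) => [|i s [y [Dy yx yg]]].
  by exists (x i0); rewrite !big_nil !mul0r.
rewrite !big_cons; set W := \sum_(j <- s) w j in yx yg *.
have W_ge0 : 0 <= W by apply: sumr_ge0.
have wi_ge0 := w_ge0 i.
have [W0|W_neq0] := eqVneq (w i + W) 0.
  have wi0 : w i = 0 by lra.
  have W'0 : W = 0 by lra.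
  exists (x i0); split => //; first by rewrite yx wi0 W'0; lra.
  by move: yg; rewrite wi0 W'0; lra.
have W_gt0 : 0 < w i + W by rewrite lt_neqAle eq_sym W_neq0 addr_ge0.
pose t := w i / (w i + W).
have t01 : 0 <= t <= 1.
  by rewrite divr_ge0 ?(ltW W_gt0) //= ler_pdivrMr // mul1r lerDl.
have tw : (w i + W) * t = w i by rewrite mulrC divfK.
have comb a b : w i * a + W * b = (w i + W) * (t * a + (1 - t) * b).
  apply/eqP; rewrite -subr_eq0.
  have -> : w i * a + W * b - (w i + W) * (t * a + (1 - t) * b) =
      (w i - (w i + W) * t) * (a - b) by ring.
  by rewrite tw subrr mul0r.
have [D' le_g] := g_concave _ _ _ (Dx i) Dy t01.
exists (t * x i + (1 - t) * y); split => //.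
  by rewrite yx comb.
apply: le_trans (ler_wpM2l (ltW W_gt0) le_g).
by rewrite -comb lerD2l.
Qed.

(** Concavity between [z] and 0 gives [t * h z <= h (t * z)]. Taking the fractions [y / (y + z)] and
    [z / (y + z)] of [y + z] and adding settles two summands; the rest is induction. *)
Lemma subadditive h (I : finType) (x : I -> R) :
  concave_on `[0, +oo[ h -> h 0 = 0 -> (forall i, 0 <= x i) ->
  h (\sum_i x i) <= \sum_i h (x i).
Proof.
move=> h_concave h0 x_ge0.
have scale (t z : R) : 0 <= t <= 1 -> 0 <= z -> t * h z <= h (t * z).
  move=> t01 z_ge0; have mem (u : R) : 0 <= u -> `[0, +oo[%classic u.
    by rewrite /= in_itv /= andbT.
  by have [_] := h_concave z 0 t (mem _ z_ge0) (mem _ (lexx 0)) t01;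
    rewrite h0 !mulr0 !addr0.
have sub2 (y z : R) : 0 <= y -> 0 <= z -> h (y + z) <= h y + h z.
  move=> y_ge0 z_ge0.
  have [yz0|yz_neq0] := eqVneq (y + z) 0.
    have -> : y = 0 by lra.
    have -> : z = 0 by lra.
    by rewrite addr0 h0 addr0.
  have yz_gt0 : 0 < y + z by rewrite lt_neqAle eq_sym yz_neq0 addr_ge0.
  have frac (u : R) : 0 <= u <= y + z -> u / (y + z) * h (y + z) <= h u.
    move=> /andP[u_ge0 u_le]; rewrite -[X in _ <= h X](divfK yz_neq0).
    apply: scale (ltW yz_gt0).
    by rewrite divr_ge0 ?(ltW yz_gt0) //= ler_pdivrMr // mul1r.
  rewrite -[leLHS]mul1r -(divff yz_neq0) mulrDl mulrDl.
  by apply: lerD; apply: frac; rewrite ?lerDl ?lerDr ?y_ge0 ?z_ge0.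
suff [] : 0 <= \sum_i x i /\ h (\sum_i x i) <= \sum_i h (x i) by [].
elim/big_ind2 : _ => [|a b c d [a0 ab] [c0 cd]|i _]; rewrite ?h0 //.
split; first exact: addr_ge0.
exact: le_trans (sub2 _ _ a0 c0) (lerD ab cd).
Qed.

(** Strictness excludes equal points and the weights 0 and 1, where both sides coincide. *)
Lemma strictly_concave_onW D g :
  (forall x y t, D x -> D y -> 0 <= t <= 1 -> D (t * x + (1 - t) * y)) ->
  strictly_concave_on D g -> concave_on D g.
Proof.
move=> D_convex gD x y t Dx Dy /andP[t0 t1]; split; first by apply: D_convex; rewrite ?t0.
have [->|xy] := eqVneq x y; first by rewrite -!mulrDl addrC subrK !mul1r.
have [->|tn0] := eqVneq t 0; first by rewrite !mul0r !add0r subr0 !mul1r.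
have [->|tn1] := eqVneq t 1; first by rewrite subrr !mul0r !addr0 !mul1r.
by apply/ltW/gD => //; rewrite !lt_neqAle eq_sym tn0 tn1 t0 t1.
Qed.

Lemma convex_function_concave g :
  convex_function [set: R^o] (g : R^o -> R^o) ->
  concave_on [set: R] (fun x => - g x).
Proof.
move=> g_convex x y t _ _ /andP[t0 t1]; split => //.
have := g_convex (Itv01 t0 t1) x y; rewrite !inE => /(_ I I).
rewrite !convRE /= /unstable.onem; lra.
Qed.

End Concavity.

(** * Squared moduli and Gram matrices *)

Section SquaredModulus.
Variable R : realType.
Local Notation C := (complex R).
Local Open Scope sesquilinear_scope.

Definition sqmod (z : C) : R := complex.Re `|z| ^+ 2.

Lemma sqmodE (z : C) : real_complex R (sqmod z) = z * (z^*)%R.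
Proof. by rewrite -normCK -[in RHS](RRe_real (normr_real z)) -rmorphXn. Qed.

Lemma sqmod_ge0 z : 0 <= sqmod z. Proof. exact: sqr_ge0. Qed.

Lemma sqmod0 : sqmod 0 = 0. Proof. by rewrite /sqmod normr0 expr0n. Qed.

Lemma sqmod_eq0 z : (sqmod z == 0) = (z == 0).
Proof. by rewrite -(inj_eq (@complexI R)) sqmodE rmorph0 mul_conjC_eq0. Qed.

Lemma sqmodM z z' : sqmod (z * z') = sqmod z * sqmod z'.
Proof.
apply: (@complexI R); rewrite sqmodE rmorphM mulrACA -!sqmodE.
exact/esym/rmorphM.
Qed.

Lemma sqmodX z n : sqmod (z ^+ n) = sqmod z ^+ n.
Proof.
elim: n => [|n IHn]; first by rewrite !expr0 /sqmod normr1 expr1n.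
by rewrite !exprS sqmodM IHn.
Qed.

Lemma gram_diag p q (M : 'M[C]_(p, q)) r :
  (M *m M^t*) r r = real_complex R (\sum_s sqmod (M r s)).
Proof.
rewrite mxE rmorph_sum; apply: eq_bigr => s _; rewrite !mxE.
exact/esym/sqmodE.
Qed.

Lemma unitary_row_sum p (V : 'M[C]_p) r :
  V \is unitarymx -> \sum_s sqmod (V r s) = 1.
Proof.
move=> /unitarymxP VV; apply: (@complexI R).
by rewrite -gram_diag VV mxE eqxx rmorph1.
Qed.

Lemma unitary_col_sum p (V : 'M[C]_p) s :
  V \is unitarymx -> \sum_r sqmod (V r s) = 1.
Proof.
rewrite -trmx_unitary => /unitary_row_sum -/(_ s) <-.
by apply: eq_bigr => r _; rewrite mxE.
Qed.

(* The row sums of squares of [B] are averages of the [d j] with respect to the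
   doubly stochastic matrix of the [|V j r|^2]. *)
Lemma sum_concave_ge p q (h : R -> R) (B : 'M[C]_(p, q)) (V : 'M[C]_p)
    (d : 'I_p -> R) :
  concave_on `[0, +oo[ h -> h 0 = 0 -> V \is unitarymx ->
  V *m B *m (V *m B)^t* = diag_mx (\row_j real_complex R (d j)) ->
  \sum_j h (d j) <= \sum_r \sum_s h (sqmod (B r s)).
Proof.
move=> h_concave h0 unitV VB.
have d_ge0 j : 0 <= d j.
  have /matrixP /(_ j j) := VB; rewrite gram_diag !mxE eqxx mulr1n.
  by move=> /(@complexI R) <-; apply: sumr_ge0 => s _; exact: sqmod_ge0.
have row_sum r : \sum_s sqmod (B r s) = \sum_j sqmod (V j r) * d j.
  apply: (@complexI R); rewrite -gram_diag.
  have -> : B *m B^t* = V^t* *m diag_mx (\row_j real_complex R (d j)) *m V.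
    rewrite -VB trmx_mul map_mxM !mulmxA.
    rewrite -[V^t* *m V *m B]mulmxA -{1 2}(invmx_unitary unitV).
    rewrite mulKmx ?unitarymx_unit // -mulmxA mulVmx ?unitarymx_unit //.
    by rewrite mulmx1.
  rewrite mxE rmorph_sum; apply: eq_bigr => j _.
  by rewrite mul_mx_diag !mxE mulrAC [_^* * _]mulrC -sqmodE; exact/esym/rmorphM.
(* The entries of a row of [V] weight [h (d j)] with total 1; those of a column are the weights for
   Jensen below. *)
apply: le_trans (_ : \sum_r \sum_j sqmod (V j r) * h (d j) <= _).
  rewrite exchange_big; apply: ler_sum => j _.
  by rewrite -mulr_suml unitary_row_sum // mul1r.
apply: ler_sum => r _.
have sub : h (\sum_s sqmod (B r s)) <= \sum_s h (sqmod (B r s)).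
  by apply: subadditive => // s; exact: sqmod_ge0.
apply: le_trans sub; rewrite row_sum.
apply: (jensen h_concave) => [j|j|]; rewrite ?sqmod_ge0 ?unitary_col_sum //.
by rewrite /= in_itv /= d_ge0.
Qed.

End SquaredModulus.

(** * Optimality *)

(** [u] and [v] give the places of rows and columns after the permutations, as naturals since [p]
    and [q] may differ. Hence no row or column has two nonzero entries. *)
Lemma pseudo_diagonalP (F : fieldType) p q (A : 'M[F]_(p, q)) :
  pseudo_diagonal A ->
  exists (u : 'I_p -> nat) (v : 'I_q -> nat), [/\ injective u, injective v &
    forall r s, A r s != 0 -> u r = v s].
Proof.
case=> P [Q [/is_perm_mxP [sigma ->] /is_perm_mxP [tau ->] /is_diag_mxP diag]].
exists (fun r => nat_of_ord (sigma^-1%g r)), (fun s => nat_of_ord (tau^-1%g s)); split.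
- by move=> r r' /val_inj /perm_inj.
- by move=> s s' /val_inj /perm_inj.
move=> r s; apply: contraNeq => /diag.
rewrite tr_perm_mx -row_permE -col_permE !mxE.
by rewrite ?invgK ?permKV ?permK => ->.
Qed.

Section Gram.
Variable R : realType.
Local Notation C := (complex R).
Local Open Scope sesquilinear_scope.

Lemma det_gram m (M : 'M[C]_m) :
  \det (M *m M^t* ) = real_complex R (sqmod (\det M)).
Proof. by rewrite det_mulmx det_map_mx det_tr sqmodE. Qed.

Lemma sqmod_det_unitary m (V : 'M[C]_m) :
  V \is unitarymx -> sqmod (\det V) = 1.
Proof.
move=> /unitarymxP VV; apply: (@complexI R).
by rewrite -det_gram VV det1.
Qed.

End Gram.

Section Optimality.
Variables (R : realType) (h : R -> R).
Local Notation C := (complex R).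
Local Open Scope sesquilinear_scope.
Hypotheses (h_concave : concave_on `[0, +oo[ h) (h0 : h 0 = 0).

Lemma unitary_optimal p q (A : 'M[C]_(p, q)) (K1 : 'M[C]_p) (K2 : 'M[C]_q) :
  pseudo_diagonal A -> K1 \is unitarymx -> K2 \is unitarymx ->
  \sum_r \sum_s h (sqmod (A r s)) <=
  \sum_r \sum_s h (sqmod ((K1 *m A *m K2^T) r s)).
Proof.
case/pseudo_diagonalP => [u [v [u_inj v_inj uv]]] unit1 unit2.
(* A row has at most one nonzero entry and [h 0 = 0], so [h] may be taken of the whole row sum. *)
have -> : \sum_r \sum_s h (sqmod (A r s)) = \sum_r h (\sum_s sqmod (A r s)).
  apply: eq_bigr => r _; have [/forallP A0|] := boolP [forall s, A r s == 0].
    rewrite [in RHS]big1 => [|s _]; last by rewrite (eqP (A0 s)) sqmod0.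
    by rewrite h0 big1 // => s _; rewrite (eqP (A0 s)) sqmod0 h0.
  rewrite negb_forall => /existsP[s As].
  have A0 s' : s' != s -> A r s' = 0.
    by apply: contraNeq => As'; apply/eqP/v_inj; rewrite -(uv _ _ As) -(uv _ _ As').
  rewrite (bigD1 s) //= big1 ?addr0 => [|s' /A0 ->]; last by rewrite sqmod0 h0.
  by rewrite (bigD1 s) //= big1 ?addr0 // => s' /A0 ->; rewrite sqmod0.
(* [K1^*] cancels [K1], and [K2] drops out of the Gram matrix; what is left, [A A^*], is diagonal
   because distinct rows of [A] have disjoint supports. *)
apply: (sum_concave_ge (V := K1^t* )) => //; first by rewrite trmxC_unitary.
have -> : K1^t* *m (K1 *m A *m K2^T) = A *m K2^T.
  by rewrite -invmx_unitary // -!mulmxA mulKmx ?unitarymx_unit.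
rewrite trmx_mul map_mxM mulmxA mulmxtVK ?trmx_unitary //.
apply/matrixP => r r'; have [<-|rr'] := eqVneq r r'.
  by rewrite gram_diag !mxE eqxx.
rewrite !mxE (negPf rr') mulr0n big1 // => s _; rewrite !mxE.
have [->|Ars] := eqVneq (A r s) 0; first by rewrite mul0r.
have [->|Ar's] := eqVneq (A r' s) 0; first by rewrite rmorph0 mulr0.
by case/eqP: rr'; apply: u_inj; rewrite (uv _ _ Ars) (uv _ _ Ar's).
Qed.

Hypothesis h_ge0 : forall x, 0 <= x -> 0 <= h x.
Hypothesis h_exp : concave_on [set: R] (fun x => - h (expR x)).

Lemma det_optimal m (B : 'M[C]_m) (lambda : C) :
  sqmod (\det B) = sqmod lambda ^+ m ->
  m%:R * h (sqmod lambda) <= \sum_r \sum_s h (sqmod (B r s)).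
Proof.
(* Settles [m = 0] and [lambda = 0], where the left side is 0. *)
have sum_ge0 : 0 <= \sum_r \sum_s h (sqmod (B r s)).
  by do 2!apply: sumr_ge0 => ? _; exact/h_ge0/sqmod_ge0.
have [m0|m_gt0] := posnP m; first by have -> : m%:R = 0 :> R; rewrite ?m0 ?mul0r.
move=> detB; have [->|lambda_neq0] := eqVneq lambda 0.
  by rewrite sqmod0 h0 mulr0.
have normalBB : B *m B^t* \is normalmx.
  by apply/normalmxP; rewrite trmx_mul map_mxM trmxCK.
pose V := spectralmx (B *m B^t* ).
have unitV : V \is unitarymx by exact: spectral_unitarymx.
(* As squared row norms these eigenvalues are real by construction. *)
pose d j := \sum_s sqmod ((V *m B) j s).
have VB : V *m B *m (V *m B)^t* = diag_mx (\row_j real_complex R (d j)).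
  have : V *m B *m (V *m B)^t* = diag_mx (spectral_diag (B *m B^t* )).
    have /orthomx_spectralP := normalBB; rewrite -/V => E.
    rewrite trmx_mul map_mxM mulmxA -(invmx_unitary unitV).
    rewrite -[V *m B *m _]mulmxA [in LHS]E.
    by rewrite !mulmxA mulmxV ?unitarymx_unit // mul1mx mulmxK ?unitarymx_unit.
  move=> E; apply/matrixP => i j; have [<-|ij] := eqVneq i j.
    by rewrite gram_diag !mxE eqxx.
  by rewrite E !mxE (negPf ij).
have prod_d : \prod_j d j = sqmod lambda ^+ m.
  rewrite -detB; apply: (@complexI R); rewrite rmorph_prod.
  have <- : \det (V *m B *m (V *m B)^t* ) = \prod_j real_complex R (d j).
    by rewrite VB det_diag; apply: eq_bigr => j _; rewrite mxE.
  by rewrite det_gram det_mulmx sqmodM (sqmod_det_unitary unitV) mul1r.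
have lambda_gt0 : 0 < sqmod lambda.
  by rewrite lt_neqAle sqmod_ge0 eq_sym sqmod_eq0 lambda_neq0.
(* No factor of a nonzero product vanishes, so [ln (d j)] may be used below. *)
have d_gt0 j : 0 < d j.
  rewrite lt_neqAle sumr_ge0 ?andbT => [|s _]; last exact: sqmod_ge0.
  rewrite eq_sym; apply: contraTneq (exprn_gt0 m lambda_gt0) => dj.
  by rewrite -prod_d (bigD1 j) //= dj mul0r ltxx.
apply: le_trans (sum_concave_ge h_concave h0 unitV VB).
have sum_w : \sum_(j < m) (m%:R^-1 : R) = 1.
  by rewrite sumr_const card_ord -[LHS]mulr_natr mulVf // pnatr_eq0 -lt0n.
(* Equal weights at the points [ln (d j)]: by the product formula their mean is
   [ln (sqmod lambda)]. *)
have := jensen (w := fun=> m%:R^-1) (x := fun j => ln (d j)) h_exp _ _ sum_w.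
have -> : \sum_j m%:R^-1 * ln (d j) = ln (sqmod lambda).
  rewrite -mulr_sumr; apply: (canLR (mulKf _)); first by rewrite pnatr_eq0 -lt0n.
  apply: expR_inj; rewrite expR_sum expRM_natl lnK // -prod_d.
  by apply: eq_bigr => j _; rewrite lnK // posrE.
rewrite lnK ?posrE // -mulr_sumr sumrN mulrN lerN2 => jen.
rewrite mulrC -ler_pdivlMr ?ltr0n // mulrC.
apply: le_trans (jen _ _) _ => //.
by under eq_bigr => j _ do rewrite lnK ?posrE //.
Qed.

(** Embeds either kind of scalars into the complex numbers, where the spectral theorem is
    available. *)
Lemma scalars_sqmod (c : scalar_kind) :
  exists phi : {rmorphism scalars R c -> C},
    forall x, sqmod (phi x) = modulus x ^+ 2.
Proof.
case: c.
  exists (real_complex R) => x; congr (_ ^+ 2).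
  by rewrite normc_def /= expr0n addr0 sqrtr_sqr.
by exists idfun.
Qed.

(** Mapped into the complex numbers, the transformed matrix has the image of [lambda ^+ m] as
    determinant, so [det_optimal] applies. *)
Lemma special_linear_optimal (c : scalar_kind) p q (A : 'M[scalars R c]_(p, q))
    (K1 : 'M[scalars R c]_p) (K2 : 'M[scalars R c]_q) :
  is_scalar_identity A -> \det K1 = 1 -> \det K2 = 1 ->
  \sum_r \sum_s h (modulus (A r s) ^+ 2) <=
  \sum_r \sum_s h (modulus ((K1 *m A *m K2^T) r s) ^+ 2).
Proof.
case=> lambda [m [hp [hq]]]; subst p; subst q; rewrite castmx_id => -> det1 det2.
have [phi phiE] := scalars_sqmod c.
have -> : \sum_r \sum_s h (modulus ((lambda%:M : 'M[scalars R c]_m) r s) ^+ 2) =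
    m%:R * h (sqmod (phi lambda)).
  rewrite -[in RHS](card_ord m) mulr_natl -sumr_const; apply: eq_bigr => r _.
  rewrite (bigD1 r) //= big1 => [|s sr]; last first.
    by rewrite -phiE mxE eq_sym (negPf sr) mulr0n rmorph0 sqmod0 h0.
  by rewrite addr0 mxE eqxx mulr1n -phiE.
pose B := map_mx phi (K1 *m lambda%:M *m K2^T).
apply: le_trans (@det_optimal _ B _ _) _.
  rewrite det_map_mx !det_mulmx det_tr det1 det2 det_scalar mulr1 mul1r.
  by rewrite rmorphXn sqmodX.
rewrite le_eqVlt; apply/orP; left; apply/eqP.
by apply: eq_bigr => r _; apply: eq_bigr => s _; rewrite mxE phiE.
Qed.

End Optimality.

(** * The infimum and its attainment *)

Theorem theorem5p10 (R : realType) (c : scalar_kind) (k : nat)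
    (n : 'I_k -> nat) (GG : forall a, set 'M[scalars R c]_(n a))
    (f : R -> R) (Z T : tensor n (scalars R c)) :
  (exists2 G : forall a, 'M[scalars R c]_(n a),
     (forall a, GG a (G a)) & T = multi_product Z G) ->
  (exists (J1 J2 : {set 'I_k}) (e1 : merging n J1) (e2 : merging n J2),
     two_grouping J1 J2 /\
     ([/\ c = ComplexScalars,
          forall a, GG a = @unitary_group R c (n a),
          pseudo_diagonal (unfolding e1 e2 Z),
          strictly_concave_on `[0, +oo[ (fun x => f (Num.sqrt x))
        & 0 <= f 0]
      \/
      ((forall a, GG a = @special_linear_group (scalars R c) (n a)) /\
       [/\ is_scalar_identity (unfolding e1 e2 Z),
           strictly_concave_on `[0, +oo[ (fun x => f (Num.sqrt x)),
           {in `[0, +oo[ &, {homo (fun x => f (Num.sqrt x)) : x y / x <= y}},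
           convex_function [set: R^o] (fun x : R => f (Num.sqrt (expR x)))
         & 0 <= f 0]))) ->
  (entry_sum f Z)%:E =
    ereal_inf [set (entry_sum f (multi_product T G))%:E
              | G in [set G : forall a, 'M[scalars R c]_(n a)
                     | forall a, GG a (G a)]].
Proof.
move=> [G GGG ->] [J1 [J2 [e1 [e2 [J12 cases]]]]].
pose h x := f (Num.sqrt x) - f 0.
have h0 : h 0 = 0 by rewrite /h sqrtr0 subrr.
have modulus_ge0 (x : scalars R c) : 0 <= modulus x.
  by case: {+}c x => [x|[a b]]; [exact: normr_ge0|exact: sqrtr_ge0].
have f_h (x : scalars R c) : f (modulus x) = h (modulus x ^+ 2) + f 0.
  by rewrite /h sqrtr_sqr ger0_norm // subrK.
(* All tensors of this format have equally many entries, so the shift by [f 0] is a common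
   constant. *)
have entry_sum_h (X : tensor n (scalars R c)) : entry_sum f X =
    \sum_r \sum_s h (modulus (unfolding e1 e2 X r s) ^+ 2) + f 0 *+ #|{: multi_index n}|.
  rewrite /entry_sum; under eq_bigr => i _ do rewrite f_h.
  rewrite big_split /= sumr_const.
  by rewrite (unfolding_sum J12 e1 e2 (fun x => h (modulus x ^+ 2))).
have concave_h : strictly_concave_on `[0, +oo[ (fun x => f (Num.sqrt x)) ->
    concave_on `[0, +oo[ h.
  move=> f_concave.
  have D_convex (x y t : R) :
      `[0, +oo[%classic x -> `[0, +oo[%classic y ->
      0 <= t <= 1 -> `[0, +oo[%classic (t * x + (1 - t) * y).
    rewrite /= !in_itv /= !andbT => x_ge0 y_ge0 /andP[t0 t1].
    by rewrite addr_ge0 ?mulr_ge0 ?subr_ge0.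
  move=> x y t Dx Dy t01.
  have [Dt le_f] := strictly_concave_onW D_convex f_concave Dx Dy t01.
  by split => //; rewrite /h; lra.
(* Both cases reduce to a comparison of matrices under a multiplicative family. *)
suff [Q [famQ QG opt]] : exists Q : forall m, set 'M[scalars R c]_m,
    [/\ multiplicative_family Q, forall a, GG a = Q (n a) &
      forall K1 K2, Q _ K1 -> Q _ K2 ->
        \sum_r \sum_s h (modulus (unfolding e1 e2 Z r s) ^+ 2) <=
        \sum_r \sum_s h (modulus ((K1 *m unfolding e1 e2 Z *m K2^T) r s) ^+ 2)].
  have QGG a : Q (n a) (G a) by rewrite -QG.
  apply/eqP; rewrite eq_le; apply/andP; split.
    apply: le_ereal_inf_tmp => _ [H GGH <-].
    have QH a : Q (n a) (H a) by rewrite -QG; exact: GGH.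
    rewrite lee_fin !entry_sum_h lerD2r.
    (* First the action of [H], then that of [G] on [Z]: together they transform the unfolding of
       [Z] by [L1 K1] and [L2 K2]. *)
    have [L1 [L2 [QL1 QL2 ->]]] :=
      unfolding_multi_product e1 e2 (multi_product Z G) J12 famQ QH.
    have [K1 [K2 [QK1 QK2 ->]]] :=
      unfolding_multi_product e1 e2 Z J12 famQ QGG.
    have := opt (L1 *m K1) (L2 *m K2)
      (familyM famQ QL1 QK1) (familyM famQ QL2 QK2).
    by rewrite trmx_mul !mulmxA.
  (* The inverse factors carry the tensor back to [Z], so the value is attained. *)
  have inv a : exists V, Q (n a) V /\ V *m G a = 1%:M.
    by have [V QV VG] := familyV famQ (QGG a); exists V.
  apply: ereal_inf_lbound; exists (fun a => sval (cid (inv a))) => /=.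
    by move=> a; rewrite QG; case: cid => V [].
  by rewrite multi_productK // => a; case: cid => V [].
case: cases => [[cE GGE diagZ f_concave _]|[GGE [scalZ f_concave f_homo f_convex _]]].
  exists (@unitary_group R c); subst c.
  split => //; first exact: multiplicative_unitary.
  move=> K1 K2 QK1 QK2.
  exact: (unitary_optimal (concave_h f_concave) h0 diagZ QK1 QK2).
exists (@special_linear_group (scalars R c)); split => //.
  exact: multiplicative_special_linear.
move=> K1 K2 QK1 QK2; apply: special_linear_optimal => //; first exact: concave_h.
  (* Monotonicity from 0 to [x] makes [h] nonnegative. *)
  move=> x x_ge0; rewrite subr_ge0 -[in leLHS]sqrtr0.
  by apply: f_homo; rewrite // in_itv /= ?lexx ?x_ge0.
move=> x y t _ _ t01; split => //.
have [_] := convex_function_concave f_convex I I t01 (x := x) (y := y).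
rewrite /h; lra.
Qed.
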